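(* Let $K$ be a field with $\sqrt{-1}\notin K$ and let $G$ be a finite simple graph on $[n]$. Then the variety $\mathrm{OR}_2^K(G)$ of orthogonal representations of $G$ in $K^2$ is the union $\bigcup_{S\subseteq[n]}V_S$ of varieties $V_S$, each of them being the zero set in $K^{n\times 2}$ of a prime ideal $Q_S$ of $K[x_1,\ldots,x_n,y_1,\ldots,y_n]$, where $V_S$ is described as follows. Let $\overline{G}_1,\ldots,\overline{G}_{c(S)}$ be the connected components of $\overline{G}\setminus S$. Then $V_S$ consists of all maps $\varphi:[n]\to K^2$ such that (a) $\varphi(i)=0$ for all $i\in S$ and for all vertices $i$ of those $\overline{G}_j$ which are non-bipartite; (b) for each bipartite connected component $\overline{G}_\ell$: (1) $\varphi(i)\perp\varphi(j)$ if $i$ and $j$ are vertices of $\overline{G}_\ell$ lying in different blocks of its vertex bipartition, and (2) $\varphi(i)$ and $\varphi(j)$ are linearly dependent if $i$ and $j$ are (distinct) vertices of $\overline{G}_\ell$ lying in the same block of its vertex bipartition. In particular, for each orthogonal representation in $V_S$ and each bipartite connected component $\overline{G}_\ell$ there is a pair of orthogonal lines (through the origin) in $K^2$ such that each of them contains the images from one block of the bipartition of $V(\overline{G}_\ell)$.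
   Context: $\sqrt{-1}\notin K$ means that no element of $K$ has square $-1$. The graph $\overline{G}$ is the complementary graph of $G$ on $[n]=\{1,\ldots,n\}$, and $\overline{G}\setminus S$ is the induced subgraph of $\overline{G}$ on $[n]\setminus S$. Orthogonality ($\perp$) is with respect to the standard scalar product $(a,b)\cdot(c,d)=ac+bd$ on $K^2$. An orthogonal representation of $G$ in $K^2$ is a map $\varphi:[n]\to K^2$ such that $\varphi(i)\perp\varphi(j)$ for every $\{i,j\}\in E(\overline{G})$; $\mathrm{OR}_2^K(G)\subseteq K^{n\times 2}$ is the set of all of them, a map $\varphi$ being identified with the matrix whose $i$-th row is $\varphi(i)$ (the values of the variables $(x_i,y_i)$). Equivalently, $\mathrm{OR}_2^K(G)$ is the zero set of the ideal $(x_ix_j+y_iy_j:\{i,j\}\in E(\overline{G}))$. A single vertex is regarded as a bipartite connected graph. The vertex bipartition of a connected bipartite graph is unique. *)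

(* Defs.v *)
From mathcomp Require Import all_boot all_order all_algebra.
From mathcomp Require Import mpoly.

Set Implicit Arguments.
Unset Strict Implicit.
Unset Printing Implicit Defensive.

Import GRing.Theory.
Local Open Scope ring_scope.

Section Graphs.
Variable T : finType.
Implicit Types (e : rel T) (D S C A B : {set T}).

Definition complement_graph e : rel T := [rel i j | (i != j) && ~~ e i j].

(* Edges of the subgraph induced on D; its vertex set D is carried separately,
   since the elements outside D become isolated points of this relation. *)
Definition induced_graph e D : rel T :=
  [rel i j | [&& i \in D, j \in D & e i j]].

(* Vertex sets of the connected components of the subgraph induced on D. *)
Definition components e D : {set {set T}} :=
  equivalence_partition (connect (induced_graph e D)) D.

Definition independent e A : bool := [forall i in A, forall j in A, ~~ e i j].

(* A and B are the blocks of a bipartition of the subgraph induced on C.  A block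
   may be empty, so that a single vertex is bipartite.  For connected C the pair
   (A, B) is unique up to exchanging A and B. *)
Definition bipartition e C A B : bool :=
  [&& A :|: B == C, [disjoint A & B], independent e A & independent e B].

Definition bipartite e C : bool :=
  [exists A : {set T}, exists B : {set T}, bipartition e C A B].

End Graphs.

Section OrthogonalRepresentations.
Variables (K : fieldType) (n : nat).

Definition dot (u v : 'rV[K]_2) : K := u 0 0 * v 0 0 + u 0 1 * v 0 1.

Definition orthogonal (u v : 'rV[K]_2) : Prop := dot u v = 0.

Definition lin_dependent (u v : 'rV[K]_2) : Prop := ~~ free [:: u; v].

Definition orthogonal_rep (e : rel 'I_n) (phi : 'M[K]_(n, 2)) : Prop :=
  forall i j : 'I_n, complement_graph e i j -> orthogonal (row i phi) (row j phi).

Definition V (e : rel 'I_n) (S : {set 'I_n}) (phi : 'M[K]_(n, 2)) : Prop :=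
  let ce := complement_graph e in
  let comps := components ce (~: S) in
  [/\ forall i, i \in S -> row i phi = 0,
      forall C, C \in comps -> ~~ bipartite ce C ->
        forall i, i \in C -> row i phi = 0
    & forall C A B, C \in comps -> bipartition ce C A B ->
        [/\ forall i j, i \in A -> j \in B ->
              orthogonal (row i phi) (row j phi),
            forall i j, i \in A -> j \in A -> i != j ->
              lin_dependent (row i phi) (row j phi)
          & forall i j, i \in B -> j \in B -> i != j ->
              lin_dependent (row i phi) (row j phi)]].

(* Point of affine space given by phi: the variables of {mpoly K[n + n]} are
   ordered x_1, ..., x_n, y_1, ..., y_n. *)
Definition coords (phi : 'M[K]_(n, 2)) (k : 'I_(n + n)) : K :=
  match split k with inl i => phi i 0 | inr i => phi i 1 end.

Definition zero_set (Q : {pred {mpoly K[n + n]}}) (phi : 'M[K]_(n, 2)) : Prop :=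
  forall p, p \in Q -> p.@[coords phi] = 0.

(* idealr_closed includes 1 \notin Q. *)
Definition prime_ideal (Q : {pred {mpoly K[n + n]}}) : Prop :=
  idealr_closed Q /\ prime_idealr_closed Q.

Definition is_line (L : {vspace 'rV[K]_2}) : Prop := \dim L = 1%N.

Definition orthogonal_lines (L M : {vspace 'rV[K]_2}) : Prop :=
  [/\ is_line L, is_line M
    & forall u v, u \in L -> v \in M -> orthogonal u v].

End OrthogonalRepresentations.

(* Main.v *)
Require Import Defs.
From mathcomp Require Import all_boot all_order all_algebra.
From mathcomp Require Import mpoly ring.
Import GRing.Theory.
Local Open Scope ring_scope.

(** Write u^ for the vector u turned by a right angle.  In the plane, u is
    orthogonal to v exactly when u and v^ are linearly dependent.  Hence, for a
    component C of the complementary graph minus S with bipartition (A, B),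
    condition (b) says that once the vectors of B have been turned, all vectors
    of C lie on one common line ([bipartition_turned]).  This single condition
    drives all three assertions.

    Union.  Let phi be an orthogonal representation and S the set of vertices
    that it sends to 0.  On a component of the complement of S no vector
    vanishes, and linear dependence is transitive through nonzero vectors.  So
    fixing a vertex i of the component and following edges, every vector of the
    component is either parallel or orthogonal to phi(i).  As -1 is not a square,
    no nonzero vector is orthogonal to itself; the two classes are therefore
    disjoint and independent, so that the component is bipartite
    ([nonvanishing_rep_bipartite]).  The same propagation along edges yields (b)
    for any bipartition ([orthogonal_rep_V]).  Conversely an edge either meets S
    or lies in one component, where (a) or (b) makes it orthogonal
    ([V_orthogonal_rep]).

    Primality.  V_S is the image of a polynomial map from an affine space: choose
    freely a direction vector w for each component and a scalar t for each
    vertex, and send the vertex to t w, turned if it lies in the second block, or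
    to 0 if it belongs to S or to a non-bipartite component.  Let Q_S be the
    kernel of the corresponding homomorphism from K[x, y] to the polynomial ring
    in the parameters; it is prime since the target is a domain.  Polynomials of
    Q_S vanish on the image V_S.  Conversely Q_S contains the coordinates and the
    2 x 2 determinants whose vanishing defines V_S, so its zero set is no larger
    ([turned_variety_zero_set]).  Over a finite field Q_S can be smaller than the
    ideal of all polynomials vanishing on V_S, and the latter need not be prime;
    this is why the ideal is taken to be the kernel.

    Lines.  The common line of a component and the same line turned are the two
    orthogonal lines ([V_orthogonal_lines]). *)

Set Implicit Arguments.
Unset Strict Implicit.
Unset Printing Implicit Defensive.

(** * Dependence and orthogonality in the plane *)

Section Plane.

Definition cross (R : comNzRingType) (u v : 'rV[R]_2) : R :=
  u 0 0 * v 0 1 - u 0 1 * v 0 0.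

(** The turn is optional so that vectors from the two blocks of a bipartition can
    be treated uniformly. *)
Definition turn (R : comNzRingType) (b : bool) (u : 'rV[R]_2) : 'rV[R]_2 :=
  if b then \row_k (if k == 0 then - u 0 1 else u 0 0) else u.

Lemma row2P (R : Type) (u v : 'rV[R]_2) :
  u 0 0 = v 0 0 -> u 0 1 = v 0 1 -> u = v.
Proof.
move=> e0 e1; apply/rowP=> k.
by case: (unliftP 0 k) => [j|] ->; rewrite ?ord1 // [lift _ _](_ : _ = 1) //;
  apply/val_inj.
Qed.

Lemma turnZ (R : comNzRingType) b (a : R) u : turn b (a *: u) = a *: turn b u.
Proof. by case: b => //; apply: row2P; rewrite !mxE //= mulrN. Qed.

Lemma turnK (R : comNzRingType) b (u : 'rV[R]_2) :
  turn b (turn b u) = (-1) ^+ b *: u.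
Proof.
by case: b => /=; [apply: row2P; rewrite !mxE /=; ring | rewrite scale1r].
Qed.

Lemma turn0 (R : comNzRingType) b : turn b (0 : 'rV[R]_2) = 0.
Proof. by have := turnZ b 0 (0 : 'rV[R]_2); rewrite !scale0r. Qed.

Lemma turn_eq0 (R : comNzRingType) b (u : 'rV[R]_2) : (turn b u == 0) = (u == 0).
Proof.
apply/eqP/eqP=> [|->]; last exact: turn0.
move/(congr1 (turn b)); rewrite turn0 turnK => /(congr1 ( *:%R ((-1) ^+ b))).
by rewrite scalerA -expr2 sqrr_sign scale1r scaler0.
Qed.

Lemma map_turn (R R' : comNzRingType) (f : {rmorphism R -> R'}) b u :
  map_mx f (turn b u) = turn b (map_mx f u).
Proof. by case: b => //; apply: row2P; rewrite !mxE //= rmorphN. Qed.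

Lemma map_cross (R R' : comNzRingType) (f : {rmorphism R -> R'}) u v :
  f (cross u v) = cross (map_mx f u) (map_mx f v).
Proof. by rewrite /cross rmorphB !rmorphM !mxE. Qed.

Lemma crossZZ (R : comNzRingType) (a b : R) u : cross (a *: u) (b *: u) = 0.
Proof. by rewrite /cross !mxE; ring. Qed.

Lemma cross0l (R : comNzRingType) b (v : 'rV[R]_2) : cross (turn b 0) v = 0.
Proof. by rewrite turn0 /cross !mxE; ring. Qed.

Lemma cross0r (R : comNzRingType) b (u : 'rV[R]_2) : cross u (turn b 0) = 0.
Proof. by rewrite turn0 /cross !mxE; ring. Qed.

Variable K : fieldType.
Implicit Types u v w : 'rV[K]_2.

Lemma crossC u v : cross u v = 0 -> cross v u = 0.
Proof.
move=> h; have -> : cross v u = - cross u v by rewrite /cross; ring.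
by rewrite h oppr0.
Qed.

Lemma dotC u v : dot u v = dot v u.
Proof. by rewrite /dot; ring. Qed.

(** Turning exactly one of two vectors exchanges dependence and orthogonality;
    turning both changes neither. *)
Lemma cross_turn b c u v :
  cross (turn b u) (turn c v) = 0 <-> (if b (+) c then dot u v else cross u v) = 0.
Proof.
rewrite (_ : cross _ _ =
  (-1) ^+ (b && ~~ c) * (if b (+) c then dot u v else cross u v)); last first.
  by rewrite /cross /dot; case: b c => [] [] /=; rewrite ?mxE /=; ring.
by split=> [/eqP|->]; rewrite ?mulr0 // mulf_eq0 signr_eq0 => /eqP.
Qed.

(** Only the relative turn of the two vectors matters; hence exchanging the blocks
    of a bipartition is harmless. *)
Lemma cross_turn_addb b b' c c' u v : b (+) b' = c (+) c' ->
  cross (turn b u) (turn c v) = 0 -> cross (turn b' u) (turn c' v) = 0.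
Proof.
move=> eq_bc /cross_turn h; apply/cross_turn.
by case: b b' c c' eq_bc h => [] [] [] [].
Qed.

Lemma cross_eq0P u w : u != 0 -> cross u w = 0 -> exists t, w = t *: u.
Proof.
move=> u0 h.
have [e0|n0] := eqVneq (u 0 0) 0.
  have n1 : u 0 1 != 0.
    by apply: contraNneq u0 => e1; apply/eqP/row2P; rewrite !mxE.
  exists (w 0 1 / u 0 1); apply: row2P; rewrite !mxE; last by rewrite divfK.
  move: h; rewrite /cross e0 mul0r sub0r mulr0 => /eqP.
  by rewrite oppr_eq0 mulf_eq0 (negPf n1) => /eqP.
exists (w 0 0 / u 0 0); apply: row2P; rewrite !mxE; first by rewrite divfK.
apply: (mulfI n0); move/eqP: h; rewrite subr_eq0 => /eqP ->; field; exact: n0.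
Qed.

Lemma cross_trans v u w : v != 0 -> cross u v = 0 -> cross v w = 0 -> cross u w = 0.
Proof.
by move=> v0 /crossC /(cross_eq0P v0)[t ->] /(cross_eq0P v0)[s ->]; apply: crossZZ.
Qed.

Lemma lin_dependentE u v : lin_dependent u v <-> cross u v = 0.
Proof.
rewrite /lin_dependent free_cons span_seq1 seq1_free negb_and !negbK; split.
  case/orP=> [/vlineP[t ->]|/eqP ->]; last exact: (cross0r false).
  by rewrite -[X in cross _ X]scale1r crossZZ.
have [//|v0 /crossC /(cross_eq0P v0)[t ->]] := eqVneq v 0; first by rewrite orbT.
by rewrite orbF; apply/vlineP; exists t.
Qed.

(** A nonzero member of the family spans the line.  If there is none, any line
    will do, and the all-ones vector is used. *)
Lemma collinear_family (I : finType) (D : {set I}) (f : I -> 'rV[K]_2) :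
  (forall i j, i \in D -> j \in D -> cross (f i) (f j) = 0) ->
  exists2 w, w != 0 & forall i, i \in D -> exists t, f i = t *: w.
Proof.
move=> cD; have [i /andP[iD fi]|f0] := pickP [pred i | (i \in D) && (f i != 0)].
  by exists (f i) => // j jD; apply: cross_eq0P (cD _ _ iD jD).
exists (const_mx 1) => [|i iD].
  by apply/eqP=> /rowP/(_ 0)/eqP; rewrite !mxE oner_eq0.
by exists 0; move: (f0 i); rewrite /= iD scale0r => /negbFE/eqP.
Qed.

(** If a ^ 2 + b ^ 2 = 0 with b nonzero, then a / b is a square root of -1. *)
Lemma dot_anisotropic (hK : ~ exists a : K, a ^+ 2 = -1) u : dot u u = 0 -> u = 0.
Proof.
rewrite /dot => h; have [e1|n1] := eqVneq (u 0 1) 0.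
  move: h; rewrite e1 mulr0 addr0 => /eqP; rewrite mulf_eq0 orbb => /eqP e0.
  by apply: row2P; rewrite !mxE.
case: hK; exists (u 0 0 / u 0 1).
rewrite expr_div_n expr2 -[u 0 0 * _](addrK (u 0 1 * u 0 1)) h sub0r -expr2 mulNr.
by rewrite divff // expf_neq0.
Qed.

End Plane.

(** * Connected components and bipartitions *)

Section Components.
Variables (T : finType) (e : rel T).
Hypothesis e_sym : ssrbool.symmetric e.
Implicit Types (D C A B : {set T}).

Lemma connect_induced_sym D : connect_sym (induced_graph e D).
Proof. by apply: sym_connect_sym => x y; rewrite /induced_graph /= e_sym andbCA. Qed.

Lemma connect_induced_equiv D :
  {in D & &, equivalence_rel (connect (induced_graph e D))}.
Proof.
move=> x y z _ _ _; split; first exact: connect0.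
by move=> exy; apply: (same_connect (@connect_induced_sym D)).
Qed.

Lemma componentsP D : partition (components e D) D.
Proof. exact: equivalence_partitionP (@connect_induced_equiv D). Qed.

Lemma mem_component D i : i \in D -> pblock (components e D) i \in components e D.
Proof. by move=> iD; rewrite pblock_mem ?(cover_partition (componentsP D)). Qed.

Lemma component_eq D C i : C \in components e D -> i \in C ->
  pblock (components e D) i = C.
Proof. by apply: def_pblock; case/and3P: (componentsP D). Qed.

Lemma component_sub D C i : C \in components e D -> i \in C -> i \in D.
Proof.
by move=> CD iC; rewrite -(cover_partition (componentsP D)); apply/bigcupP; exists C.
Qed.

Lemma component_edge D i j : i \in D -> j \in D -> e i j ->
  j \in pblock (components e D) i.
Proof.
move=> iD jD eij; rewrite (pblock_equivalence_partition (@connect_induced_equiv D)) //.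
by apply: connect1; rewrite /induced_graph /= iD jD.
Qed.

(** The form in which connectedness is used: a property of one vertex which
    propagates along edges holds on the whole component. *)
Lemma component_ind D C (P : pred T) i : C \in components e D -> i \in C -> P i ->
  (forall x y, x \in C -> y \in C -> e x y -> P x -> P y) ->
  forall j, j \in C -> P j.
Proof.
move=> CD iC Pi step j jC.
have : connect (induced_graph e D) i j.
  rewrite -(pblock_equivalence_partition (@connect_induced_equiv D)) ?(component_sub CD) //.
  by rewrite -/(components e D) (component_eq CD iC).
case/connectP=> p; elim: p i iC Pi => [|y p IH] x xC Px /=; first by move=> _ ->.
case/andP=> /and3P[xD yD exy]; have yC : y \in C.
  by rewrite -(component_eq CD xC) component_edge.
exact: IH (step _ _ xC yC exy Px).
Qed.

Lemma bipartition_edge C A B i j : bipartition e C A B ->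
  i \in C -> j \in C -> e i j -> (j \in B) = (i \notin B).
Proof.
case/and4P=> /eqP <- _ iA iB; rewrite !inE => iAB jAB eij.
have indep X : independent e X -> i \in X -> j \in X -> False.
  move=> /'forall_implyP iX iX' jX.
  by move/'forall_implyP: (iX i iX') => /(_ j jX); rewrite eij.
have [iB'|iB'] := boolP (i \in B).
  by apply/negP=> jB; apply: indep iB iB' jB.
apply: contraTT jAB => jB; rewrite (negPf jB) orbF.
by apply/negP; apply: indep iA _; rewrite (negPf iB') orbF in iAB.
Qed.

Lemma mem_bipartition C A B i : bipartition e C A B ->
  (i \in A) = (i \in C) && (i \notin B).
Proof.
case/and4P=> /eqP <- /pred0P /(_ i) /= dAB _ _.
by rewrite inE; case: (i \in A) (i \in B) dAB => [] [].
Qed.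

(** Each edge changes the block in both bipartitions, so whether two bipartitions
    agree at a vertex does not change along edges. *)
Lemma bipartition_unique D C A B A' B' i j :
  C \in components e D -> bipartition e C A B -> bipartition e C A' B' ->
  i \in C -> j \in C ->
  (i \in B) (+) (i \in B') = (j \in B) (+) (j \in B').
Proof.
move=> CD bp bp' iC jC; apply/eqP; move: j jC.
apply: (component_ind CD iC) => // x y xC yC exy /eqP ->.
rewrite (bipartition_edge bp xC yC exy) (bipartition_edge bp' xC yC exy).
by rewrite addbN addNb negbK.
Qed.

End Components.

(** * Collinearity varieties are zero sets of prime ideals *)

Section TurnedVariety.
Variables (K : fieldType) (n : nat).

(** The coordinates of a family of n vectors in the order x_1, ..., x_n, y_1,
    ..., y_n used by [coords]. *)
Definition flat (R : Type) (u : 'I_n -> 'rV[R]_2) (k : 'I_(n + n)) : R :=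
  match split k with inl i => u i 0 0 | inr i => u i 0 1 end.

Lemma coordsE (phi : 'M[K]_(n, 2)) : coords phi =1 flat (fun i => row i phi).
Proof. by move=> k; rewrite /coords /flat; case: split => i; rewrite mxE. Qed.

Lemma map_flat (R R' : nzRingType) (f : R -> R') u k :
  f (flat u k) = flat (fun i => map_mx f (u i)) k.
Proof. by rewrite /flat; case: split => i; rewrite mxE. Qed.

(** The i-th vector of a family whose coordinates are variables.  The map h places
    the 2n variables of such a family among those of a larger polynomial ring, so
    that both the universal point and the free direction vectors of the
    parametrization are instances. *)
Definition generic_row N (h : 'I_(n + n) -> 'I_N) (i : 'I_n) : 'rV[{mpoly K[N]}]_2 :=
  \row_k 'X_(h (if k == 0 then lshift n i else rshift n i)).

Lemma map_generic_row N (R : Type) (f : {mpoly K[N]} -> R)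
    h (u : 'I_n -> 'rV[R]_2) i :
  (forall k, f 'X_(h k) = flat u k) -> map_mx f (generic_row h i) = u i.
Proof.
move=> fX; apply: row2P; rewrite !mxE /= fX /flat.
  by rewrite (unsplitK (inl i)).
by rewrite (unsplitK (inr i)).
Qed.

Lemma kernel_prime_ideal (R : comNzRingType) (R' : idomainType)
    (f : {rmorphism R -> R'}) :
  let Q := [pred p | f p == 0] in idealr_closed Q /\ prime_idealr_closed Q.
Proof.
split=> [|p q]; last by rewrite !inE rmorphM mulf_eq0.
split=> [||a p q]; rewrite !inE ?rmorph0 ?rmorph1 ?oner_eq0 // => /eqP p0 /eqP q0.
by rewrite rmorphD rmorphM p0 q0 mulr0 addr0.
Qed.

Variables (Z : {set 'I_n}) (b : 'I_n -> bool) (r : 'I_n -> 'I_n).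

(** V_S without its graph: b tells which vectors are turned, and the fibres of r
    are the classes whose turned vectors share a line.  A class may contain
    elements of Z, since the zero vector lies on every line. *)
Definition turned_variety (phi : 'M[K]_(n, 2)) : Prop :=
  (forall i, i \in Z -> row i phi = 0) /\
  (forall i j, r i = r j ->
     cross (turn (b i) (row i phi)) (turn (b j) (row j phi)) = 0).

(** The parametrization over an arbitrary ring: it is used with free variables to
    define the ideal, and with scalars to reach the points of the variety. *)
Definition param (R : comNzRingType) (t : 'I_n -> R) (w : 'I_n -> 'rV[R]_2) i :=
  if i \in Z then 0 else turn (b i) (t i *: w (r i)).

Lemma map_param (R R' : comNzRingType) (f : {rmorphism R -> R'}) t w i :
  map_mx f (param t w i) = param (f \o t) (fun k => map_mx f (w k)) i.
Proof.
by rewrite /param; case: ifP => _; rewrite ?map_mx0 // map_turn map_mxZ.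
Qed.

Lemma cross_param (R : comNzRingType) t (w : 'I_n -> 'rV[R]_2) i j : r i = r j ->
  cross (turn (b i) (param t w i)) (turn (b j) (param t w j)) = 0.
Proof.
rewrite /param => rij; case: ifP => _; first by rewrite cross0l.
by case: ifP => _; rewrite ?cross0r // !turnK !scalerA rij crossZZ.
Qed.

(** Every point of the variety is attained, not only a dense set of them: each
    class lies on a line, whose direction vector serves as w. *)
Lemma turned_variety_param phi : turned_variety phi ->
  exists t w, forall i, row i phi = param t w i.
Proof.
case=> phiZ phir.
have /fin_all_exists[w wP] (k : 'I_n) : exists w : 'rV[K]_2, forall i, r i = k ->
    exists t, turn (b i) (row i phi) = t *: w.
  have [|w _ wP] := @collinear_family K _ [set i | r i == k]
    (fun i => turn (b i) (row i phi)).
    by move=> i j; rewrite !inE => /eqP ri /eqP rj; apply: phir; rewrite ri.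
  by exists w => i ri; apply: wP; rewrite inE ri.
have /fin_all_exists[t tP] (i : 'I_n) : exists t,
    row i phi = turn (b i) (t *: w (r i)).
  have [t tP] := wP _ i erefl; exists ((-1) ^+ b i * t).
  (* Turning twice is multiplication by -1, which the scalar compensates. *)
  by rewrite -scalerA -tP turnZ turnK scalerA -expr2 sqrr_sign scale1r.
by exists t, w => i; rewrite /param; case: ifP => [/phiZ|].
Qed.

(* The first 2n parameters are the coordinates of the direction vectors, one for
   each value of r; the last n are the scalars. *)
Let N := (n + n + n)%N.
Let tX (i : 'I_n) : {mpoly K[N]} := 'X_(rshift (n + n) i).
Let paramX : (n + n).-tuple {mpoly K[N]} :=
  [tuple flat (param tX (generic_row (lshift n))) k | k < n + n].

Definition turned_ideal : {pred {mpoly K[n + n]}} :=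
  [pred p | p \mPo paramX == 0].

Lemma turned_ideal_prime : prime_ideal turned_ideal.
Proof. exact: kernel_prime_ideal. Qed.

(** A point of the variety is the value of the parametrization at a point v of
    the parameter space, so evaluating p there is evaluating at v the substituted
    polynomial, which is 0 when p is in the ideal.  Conversely, the substitution
    kills the coordinates indexed by Z and the determinants of the turned rows,
    so that these equations hold on the zero set. *)
Lemma turned_variety_zero_set phi :
  turned_variety phi <-> zero_set turned_ideal phi.
Proof.
split=> [/turned_variety_param[t [w phiE]] p|phi0].
  rewrite inE => /eqP p0.
  pose v (k : 'I_N) := match split k with inl k' => flat w k' | inr i => t i end.
  have <- : (p \mPo paramX).@[v] = p.@[coords phi]; last by rewrite p0 meval0.
  rewrite comp_mpoly_meval; apply: meval_eq => k.
  rewrite tnth_mktuple coordsE map_flat /flat.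
  have param_v i : map_mx (meval v) (param tX (generic_row (lshift n)) i) = row i phi.
    rewrite map_param phiE /param; case: ifP => // _; congr (turn _ (_ *: _)).
      by rewrite /= mevalXU /v (unsplitK (inr i)).
    by apply: (map_generic_row (f := meval v)) => l; rewrite mevalXU /v (unsplitK (inl l)).
  by case: split => i; rewrite param_v.
have compX i : map_mx (comp_mpoly paramX) (generic_row id i) =
    param tX (generic_row (lshift n)) i.
  by apply: map_generic_row => k; rewrite comp_mpolyXU -tnth_nth tnth_mktuple.
have evalX i : map_mx (meval (coords phi)) (generic_row id i) = row i phi.
  by apply: (map_generic_row (u := fun i => row i phi)) => k; rewrite mevalXU coordsE.
split=> [i iZ|i j rij].
  apply/rowP=> k; rewrite -evalX !mxE; apply: phi0; rewrite inE.
  have /rowP/(_ k) := compX i; rewrite /param iZ !mxE => ->.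
  by rewrite eqxx.
rewrite -!evalX -!map_turn -map_cross; apply: phi0.
by rewrite inE map_cross !map_turn !compX cross_param.
Qed.

End TurnedVariety.

(** * The varieties V_S *)

Section Representations.
Variables (K : fieldType) (n : nat) (e : rel 'I_n).
Hypothesis e_sym : ssrbool.symmetric e.
Let ce := complement_graph e.

Lemma complement_sym : ssrbool.symmetric ce.
Proof. by move=> i j; rewrite /ce /complement_graph /= eq_sym e_sym. Qed.

(** Both sides differ in form only: on A x B one vector is turned, giving
    orthogonality, and on A x A or B x B none or both, giving dependence. *)
Lemma bipartition_turned C A B (phi : 'M[K]_(n, 2)) : bipartition ce C A B ->
  [/\ forall i j, i \in A -> j \in B -> Defs.orthogonal (row i phi) (row j phi),
      forall i j, i \in A -> j \in A -> i != j -> lin_dependent (row i phi) (row j phi)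
    & forall i j, i \in B -> j \in B -> i != j -> lin_dependent (row i phi) (row j phi)]
  <-> (forall i j, i \in C -> j \in C ->
         cross (turn (i \in B) (row i phi)) (turn (j \in B) (row j phi)) = 0).
Proof.
move=> bp; have memA i := mem_bipartition i bp.
have BC i : i \in B -> i \in C.
  by case/and4P: bp => /eqP <- _ _ _; rewrite inE orbC => ->.
split=> [[hAB hAA hBB] i j iC jC|h].
  apply/cross_turn; have [-> | ij] := eqVneq i j.
    by rewrite addbb -[row j phi]scale1r crossZZ.
  have [iB|iB] := boolP (i \in B); have [jB|jB] := boolP (j \in B) => /=.
  - by apply/lin_dependentE/hBB.
  - by rewrite dotC; apply: hAB; rewrite ?memA ?jC.
  - by apply: hAB; rewrite ?memA ?iC.
  - by apply/lin_dependentE/hAA; rewrite // memA ?iC ?jC.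
split=> i j.
- rewrite memA => /andP[iC iB] jB.
  by have /cross_turn := h i j iC (BC _ jB); rewrite jB (negPf iB).
- rewrite !memA => /andP[iC iB] /andP[jC jB] _; apply/lin_dependentE.
  by have /cross_turn := h i j iC jC; rewrite (negPf iB) (negPf jB).
move=> iB jB _; apply/lin_dependentE.
by have /cross_turn := h i j (BC _ iB) (BC _ jB); rewrite iB jB.
Qed.

Lemma V_orthogonal_rep S (phi : 'M[K]_(n, 2)) : V e S phi -> orthogonal_rep e phi.
Proof.
case=> phiS phiN phiB i j eij; rewrite /Defs.orthogonal.
have [iS|iS] := boolP (i \in S); first by rewrite phiS // /dot !mxE !mul0r addr0.
have [jS|jS] := boolP (j \in S).
  by rewrite (phiS j) // /dot !mxE !mulr0 addr0.
have iD : i \in ~: S by rewrite inE.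
have jD : j \in ~: S by rewrite inE.
set C := pblock (components ce (~: S)) i.
have CS : C \in components ce (~: S) := mem_component complement_sym iD.
have jC : j \in C := component_edge complement_sym iD jD eij.
have iC : i \in C.
  by rewrite mem_pblock (cover_partition (componentsP complement_sym _)).
have [|nbp] := boolP (bipartite ce C); last first.
  by rewrite (phiN C) // /dot !mxE !mul0r addr0.
case/existsP=> A /existsP[B bp].
have /(bipartition_turned phi bp)/(_ i j iC jC)/cross_turn := phiB C A B CS bp.
by rewrite (bipartition_edge bp iC jC eij); case: (i \in B).
Qed.

(** The blocks are the vertices whose vectors are parallel, respectively
    orthogonal, to that of a fixed vertex i. *)
Lemma nonvanishing_rep_bipartite (hK : ~ exists a : K, a ^+ 2 = -1)
    (phi : 'M[K]_(n, 2)) D C :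
  orthogonal_rep e phi -> C \in components ce D ->
  (forall i, i \in C -> row i phi != 0) -> bipartite ce C.
Proof.
move=> phiO CD nz; have [->|[i iC]] := set_0Vmem C.
  apply/existsP; exists set0; apply/existsP; exists set0.
  rewrite /bipartition setU0 eqxx -setI_eq0 setI0 eqxx andbb.
  by apply/'forall_implyP => x; rewrite inE.
pose u j := row j phi.
have aniso j : j \in C -> cross (u j) (turn true (u j)) <> 0.
  move=> jC /(cross_turn false) /(dot_anisotropic hK) uj0.
  by move: (nz j jC); rewrite -/(u j) uj0 eqxx.
(* Turning decides the block: X false holds the parallels, X true the orthogonals. *)
pose X c := [set j in C | cross (u i) (turn c (u j)) == 0].
have indepX c : independent ce (X c).
  apply/'forall_implyP => x; rewrite inE => /andP[xC /eqP ix].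
  apply/'forall_implyP => y; rewrite inE => /andP[yC /eqP iy].
  apply/negP=> xy; apply: (aniso y yC).
  apply: (cross_trans (v := u x)); first exact: nz.
    have /cross_turn := cross_trans (nz i iC) (crossC ix) iy.
    by rewrite addbb => /crossC.
  by apply/(cross_turn false); apply: phiO.
apply/existsP; exists (X false); apply/existsP; exists (X true).
rewrite /bipartition !indepX !andbT; apply/andP; split; last first.
  apply/pred0P => x /=; rewrite !inE; apply/negP.
  move=> /andP[/andP[xC /eqP ix] /andP[_ /eqP jx]].
  exact: aniso x xC (cross_trans (nz i iC) (crossC ix) jx).
rewrite eqEsubset; apply/andP; split; apply/subsetP=> j.
  by rewrite !inE => /orP[] /andP[].
move: j; apply: (component_ind complement_sym CD iC).
  by rewrite !inE iC /= -[u i]scale1r crossZZ eqxx.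
have step x y c : x \in C -> y \in C -> ce x y -> x \in X c -> y \in X (~~ c).
  rewrite !inE => xC -> xy /andP[_ /eqP ix] /=; apply/eqP.
  apply: cross_trans ix _; first by rewrite turn_eq0 nz.
  by apply/cross_turn; rewrite addbN addbb; apply: phiO.
move=> x y xC yC xy; rewrite !in_setU orbC => /orP[] /(step x y _ xC yC xy) -> //.
by rewrite orbT.
Qed.

(** The set S of zeros is the right choice because dependence is transitive only
    through nonzero vectors. *)
Lemma orthogonal_rep_V (hK : ~ exists a : K, a ^+ 2 = -1) (phi : 'M[K]_(n, 2)) :
  orthogonal_rep e phi -> V e [set i | row i phi == 0] phi.
Proof.
move=> phiO; set S := [set i | _].
have nz C i : C \in components ce (~: S) -> i \in C -> row i phi != 0.
  by move=> CS /(component_sub complement_sym CS); rewrite !inE.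
split=> [i|C CS|C A B CS bp]; first by rewrite inE => /eqP.
  by rewrite (nonvanishing_rep_bipartite hK phiO CS (nz C ^~ CS)).
apply/(bipartition_turned phi bp) => i j iC jC.
apply/eqP; move: j jC; apply: (component_ind complement_sym CS iC).
  by rewrite -[turn _ _]scale1r crossZZ.
move=> x y xC yC exy /eqP hx; apply/eqP; apply: cross_trans hx _.
  by rewrite turn_eq0 (nz C).
apply/cross_turn; rewrite (bipartition_edge bp xC yC exy) addbN addbb.
exact: phiO.
Qed.

Lemma V_orthogonal_lines S (phi : 'M[K]_(n, 2)) C A B :
  V e S phi -> C \in components ce (~: S) -> bipartition ce C A B ->
  exists L M : {vspace 'rV[K]_2},
    [/\ orthogonal_lines L M,
        forall i, i \in A -> row i phi \in L
      & forall i, i \in B -> row i phi \in M].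
Proof.
case=> _ _ phiB CS bp.
have [w w0 wP] := collinear_family (proj1 (bipartition_turned phi bp) (phiB C A B CS bp)).
exists <[w]>%VS, <[turn true w]>%VS; split=> [|i|i iB].
- split; rewrite /is_line ?dim_vline ?turn_eq0 ?w0 // => u v.
  move=> /vlineP[s ->] /vlineP[t ->]; rewrite /Defs.orthogonal -turnZ.
  by rewrite -[_ = 0](cross_turn false true) turnK scalerA crossZZ.
- rewrite (mem_bipartition i bp) => /andP[iC /negPf iB].
  by have [t] := wP i iC; rewrite iB /= => ->; apply/vlineP; exists t.
have iC : i \in C by case/and4P: bp => /eqP <- _ _ _; rewrite inE orbC iB.
have [t /(congr1 (turn true))] := wP i iC; rewrite iB turnK turnZ scaleN1r => h.
by apply/vlineP; exists (- t); rewrite scaleNr -h opprK.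
Qed.

(** * V_S as a collinearity variety *)

Variable S : {set 'I_n}.
Let comp := pblock (components ce (~: S)).

Definition vanishing_vertices : {set 'I_n} :=
  [set i | (i \in S) || ~~ bipartite ce (comp i)].

(** One bipartition is selected for each component; [bipartition_unique] shows that
    the choice is immaterial. *)
Definition second_block (i : 'I_n) : bool :=
  if [pick AB | bipartition ce (comp i) AB.1 AB.2] is Some AB then i \in AB.2
  else false.

(** A label shared by exactly the vertices of one component.  For i in S, where
    comp i is empty, the value is a dummy. *)
Definition component_rep (i : 'I_n) : 'I_n := odflt i [pick j in comp i].

Lemma mem_comp i : i \notin S -> i \in comp i.
Proof.
by move=> iS; rewrite mem_pblock (cover_partition (componentsP complement_sym _)) inE.
Qed.

Lemma component_rep_eq i j : i \notin S -> j \notin S ->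
  (component_rep i == component_rep j) = (comp i == comp j).
Proof.
have rep k : k \notin S -> component_rep k \in comp k.
  move=> kS; rewrite /component_rep; case: pickP => [//|/(_ k)].
  by rewrite mem_comp.
have tI : trivIset (components ce (~: S)).
  by case/and3P: (componentsP complement_sym (~: S)).
move=> iS jS; apply/eqP/eqP => [eq_r|eq_c].
  by rewrite /comp -(same_pblock tI (rep i iS)) eq_r (same_pblock tI (rep j jS)).
rewrite /component_rep eq_c; case: pickP => [//|/(_ j)].
by rewrite mem_comp.
Qed.

Lemma second_blockP i : bipartite ce (comp i) ->
  exists A B, bipartition ce (comp i) A B /\
    forall j, comp j = comp i -> second_block j = (j \in B).
Proof.
case/existsP=> A0 /existsP[B0 bp0].
case E : [pick AB | bipartition ce (comp i) AB.1 AB.2] => [AB|]; last first.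
  by case: pickP E => // /(_ (A0, B0)); rewrite /= bp0.
exists AB.1, AB.2; split; first by case: pickP E => // ? ? [<-].
by move=> j eq_c; rewrite /second_block eq_c E.
Qed.

(** The graph conditions concern all bipartitions of a component, the collinearity
    variety only the selected one; these agree up to exchanging the blocks. *)
Lemma V_turned_variety (phi : 'M[K]_(n, 2)) :
  V e S phi <-> turned_variety vanishing_vertices second_block component_rep phi.
Proof.
have compS i : i \notin S -> comp i \in components ce (~: S).
  by move=> iS; apply: (mem_component complement_sym); rewrite inE.
split=> [[phiS phiN phiB]|[phiZ phir]].
  have phiZ i : i \in vanishing_vertices -> row i phi = 0.
    rewrite inE; have [/phiS //|iS] := boolP (i \in S).
    by move=> /= nbp; apply: (phiN _ (compS i iS) nbp); apply: mem_comp.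
  split=> // i j rij.
  have [/phiZ ->|iZ] := boolP (i \in vanishing_vertices); first exact: cross0l.
  have [/phiZ ->|jZ] := boolP (j \in vanishing_vertices); first exact: cross0r.
  move: iZ jZ; rewrite !inE !negb_or !negbK => /andP[iS bi] /andP[jS _].
  have /eqP eq_c : comp i == comp j by rewrite -component_rep_eq ?rij.
  have [A [B [bp sb]]] := second_blockP bi.
  rewrite !sb //; have := phiB _ A B (compS i iS) bp.
  by move/(bipartition_turned phi bp); apply; rewrite ?[in j \in _]eq_c mem_comp.
have phiC C i : C \in components ce (~: S) -> i \in C -> i \notin S /\ comp i = C.
  move=> CS iC; rewrite /comp (component_eq complement_sym CS iC); split=> //.
  by have := component_sub complement_sym CS iC; rewrite inE.
split=> [i iS|C CS nbp i iC|C A B CS bp].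
- by apply: phiZ; rewrite inE iS.
- by have [iS ci] := phiC C i CS iC; apply: phiZ; rewrite inE ci nbp orbT.
apply/(bipartition_turned phi bp) => i j iC jC.
have [iS ci] := phiC C i CS iC; have [jS cj] := phiC C j CS jC.
have bi : bipartite ce (comp i).
  by rewrite ci; apply/existsP; exists A; apply/existsP; exists B.
have [A' [B' [bp' sb]]] := second_blockP bi; rewrite ci in bp'.
have /eqP rij : component_rep i == component_rep j by rewrite component_rep_eq // ci cj.
apply: cross_turn_addb (phir i j rij); rewrite !sb ?ci //.
exact: (bipartition_unique complement_sym CS bp' bp iC jC).
Qed.

End Representations.

Theorem theorem1p4 (K : fieldType) (hK : ~ exists a : K, a ^+ 2 = -1)
    (n : nat) (e : rel 'I_n) (e_sym : ssrbool.symmetric e) (e_irr : irreflexive e) :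
  [/\ forall phi : 'M[K]_(n, 2),
        orthogonal_rep e phi <-> exists S : {set 'I_n}, V e S phi,
      forall S : {set 'I_n}, exists Q : {pred {mpoly K[n + n]}},
        prime_ideal Q /\
        (forall phi : 'M[K]_(n, 2), V e S phi <-> zero_set Q phi)
    & forall (S : {set 'I_n}) (phi : 'M[K]_(n, 2)), V e S phi ->
        forall C A B : {set 'I_n},
        C \in components (complement_graph e) (~: S) ->
        bipartition (complement_graph e) C A B ->
        exists L M : {vspace 'rV[K]_2},
          [/\ orthogonal_lines L M,
              forall i, i \in A -> row i phi \in L
            & forall i, i \in B -> row i phi \in M]].
Proof.
split=> [phi|S|S phi phiV C A B].
- split=> [/(orthogonal_rep_V e_sym hK) phiV|[S]]; last exact: V_orthogonal_rep.
  by exists [set i | row i phi == 0].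
- exists (turned_ideal (K := K) (vanishing_vertices e S) (second_block e S) (component_rep e S)).
  split; first exact: turned_ideal_prime.
  move=> phi; apply: iff_trans (V_turned_variety e_sym S phi) _.
  exact: turned_variety_zero_set.
by move=> CS bp; exact: (V_orthogonal_lines phiV CS bp).
Qed.
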